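(* The (unbiased) one-sided transposition shuffle $\mathrm{OST}_n$ on $S_n$ exhibits a cutoff in separation distance at time $n\log n$.
   Context: $\mathrm{OST}_n$ is the random walk on $S_n$ driven by the distribution $\mathrm{OST}_n((i\,j))=\frac1{nj}$ for $1\le i\le j\le n$ (each $(i\,i)$ being the identity, which thus has total mass $H_n/n$, $H_n=\sum_{k=1}^n1/k$), and $0$ elsewhere. $\pi_n$ is the uniform distribution on $S_n$. $P^t$ denotes the $t$-fold convolution of $P$ (law at time $t$ of the walk started from the identity); for a real $s\ge0$, $P^s$ means $P^{\lfloor s\rfloor}$. Separation distance: $\lVert P^t-\pi\rVert_{\mathrm{Sep}}=\max_{h}\bigl(1-\frac{P^t(h)}{\pi(h)}\bigr)$. A sequence of random walks $P_n$ with stationary distributions $\pi_n$ exhibits a cutoff in separation distance at time $t_n$ if there is a window $w_n=o(t_n)$ with $\lim_{c\to\infty}\limsup_{n\to\infty}\lVert P_n^{t_n+cw_n}-\pi_n\rVert_{\mathrm{Sep}}=0$ and $\lim_{c\to\infty}\liminf_{n\to\infty}\lVert P_n^{t_n-cw_n}-\pi_n\rVert_{\mathrm{Sep}}=1$. *)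

(* Defs.v *)
From HB Require Import structures.
From mathcomp Require Import all_boot all_order all_algebra all_fingroup.
From mathcomp Require Import all_classical all_reals all_analysis.

Set Implicit Arguments.
Unset Strict Implicit.
Unset Printing Implicit Defensive.

Import Order.TTheory GRing.Theory Num.Theory.
Import numFieldNormedType.Exports.

Local Open Scope classical_set_scope.
Local Open Scope ring_scope.

Section RandomWalk.
Context {R : realType}.

Section FiniteGroup.
Variable gT : finGroupType.
Implicit Types P Q pi : gT -> R.

Definition conv P Q : gT -> R :=
  fun g => \sum_(h : gT) P h * Q (h^-1 * g)%g.

Definition conv_pow P (t : nat) : gT -> R :=
  iter t (conv P) (fun g => (g == 1%g)%:R).

(* [Num.truncn s] is the integer part of [s] when [0 <= s], and [0] when
   [s < 0]. In [sep_cutoff] with [t] eventually nonnegative, [w] is [o(t)], so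
   for fixed [c] the time [t n - c * w n] is negative for finitely many [n]. *)
Definition walk_at P (s : R) : gT -> R := conv_pow P (Num.truncn s).

Definition uniform_dist : gT -> R := fun=> #|gT|%:R^-1.

(* Starting the iterated maximum at the value of the identity makes it the
   maximum over the group, with no extraneous lower bound. *)
Definition sep_dist P pi : R :=
  \big[Num.max/(1 - P 1%g / pi 1%g)]_(h : gT) (1 - P h / pi h).

End FiniteGroup.

(* The upper and lower limits in [n] are taken in the extended reals, where
   they always exist. *)
Definition sep_cutoff (gT : nat -> finGroupType)
    (P pi : forall n, gT n -> R) (t : R^nat) : Prop :=
  exists w : R^nat,
    [/\ forall n, 0 < w n,
        w =o_\oo t,
        limn_esup (fun n =>
          (sep_dist (walk_at (P n) (t n + c * w n)) (pi n))%:E)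
          @[c --> +oo] --> 0%E
      & limn_einf (fun n =>
          (sep_dist (walk_at (P n) (t n - c * w n)) (pi n))%:E)
          @[c --> +oo] --> 1%E].

(* An index [i : 'I_n] stands for the card position [i.+1]. The pairs with
   [i = j] contribute through [tperm j j = 1]. *)
Definition OST (n : nat) : 'S_n -> R :=
  fun s => \sum_(j < n) \sum_(i < n | (i <= j)%N && (tperm i j == s))
             (n%:R * j.+1%:R)^-1.

End RandomWalk.

(* Main.v *)
(* Let X_j be the uniform average of the transpositions (i j), i <= j, in the
   group algebra of S_n. The X_j commute (X_j is an affine function of the j-th
   Jucys-Murphy element) and the product of all of them is the uniform
   distribution, so once every j has been drawn the walk is exactly uniform:
   the separation distance at time t is at most the probability that a coupon
   collector with n coupons needs more than t draws, i.e. n (1 - 1/n)^t.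
   Conversely, the last m ~ n / ln n positions are each touched at rate about
   1/n. The touching events of two of them are negatively correlated, so a
   second moment computation shows that at time n ln n - 2 n sqrt(ln n) one of
   them is untouched, hence a fixed point, with high probability, whereas at
   least half of S_n fixes none of them. *)

Require Import Defs.
From mathcomp Require Import all_boot all_order all_algebra all_fingroup.
From mathcomp Require Import all_classical all_reals all_analysis.
From mathcomp Require Import ring lra zify.

Set Implicit Arguments.
Unset Strict Implicit.
Unset Printing Implicit Defensive.

Import Order.TTheory GRing.Theory Num.Theory.
Import numFieldNormedType.Exports.
Import Defs.
Local Open Scope ring_scope.

(** * Expectations over sequences of independent steps, up to the second moment bound *)

Section SequenceExpectation.
Context {R : realType} {T : finType}.
Implicit Types (w : T -> R) (F G : seq T -> R) (t : nat).

(** The integral of [F] against the [t]-fold product of the weight [w], as an iterated sum so that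
    its properties follow by induction on the first step. *)
Fixpoint seq_expect w t F : R :=
  if t is t'.+1 then \sum_x w x * seq_expect w t' (fun s => F (x :: s))
  else F [::].

Lemma eq_seq_expect w t F G : F =1 G -> seq_expect w t F = seq_expect w t G.
Proof.
elim: t F G => [|t IH] F G FG //=.
by apply: eq_bigr => x _; congr (_ * _); apply: IH => s; exact: FG.
Qed.

Lemma le_seq_expect w t F G : (forall x, 0 <= w x) ->
  (forall s, F s <= G s) -> seq_expect w t F <= seq_expect w t G.
Proof.
move=> w0; elim: t F G => [|t IH] F G FG //=.
by apply: ler_sum => x _; apply: ler_wpM2l => //; apply: IH => s; exact: FG.
Qed.

Lemma seq_expectZ w t (a : R) F :
  seq_expect w t (fun s => a * F s) = a * seq_expect w t F.
Proof.
elim: t F => [|t IH] F //=.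
by rewrite mulr_sumr; apply: eq_bigr => x _; rewrite IH mulrCA.
Qed.

Lemma seq_expect_sum (I : Type) (r : seq I) (P : pred I)
    w t (F : I -> seq T -> R) :
  seq_expect w t (fun s => \sum_(i <- r | P i) F i s) =
  \sum_(i <- r | P i) seq_expect w t (F i).
Proof.
elim: t F => [|t IH] F //=.
rewrite exchange_big /=; apply: eq_bigr => x _.
by rewrite IH mulr_sumr.
Qed.

Lemma seq_expectD w t F G :
  seq_expect w t (fun s => F s + G s) = seq_expect w t F + seq_expect w t G.
Proof.
elim: t F G => [|t IH] F G //=.
by rewrite -big_split /=; apply: eq_bigr => x _; rewrite IH mulrDr.
Qed.

(** Independence of the steps: the indicator of [all] factors, so the iterated sum does too. *)
Lemma seq_expect_all w t (a : pred T) :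
  seq_expect w t (fun s => (all a s)%:R) = (\sum_(x | a x) w x) ^+ t.
Proof.
elim: t => [|t IH] //=.
rewrite exprS mulr_suml [RHS]big_mkcond /=; apply: eq_bigr => x _.
case: ifP => ax /=; last first.
  rewrite (eq_seq_expect w t (G := fun=> 0 * 1)) => [|s].
    by rewrite seq_expectZ mul0r mulr0.
  by rewrite mul0r.
by rewrite IH.
Qed.

Lemma seq_expect1 w t : \sum_x w x = 1 -> seq_expect w t (fun=> 1) = 1.
Proof.
move=> w1; rewrite -[RHS](expr1n _ t) -w1 -(seq_expect_all w t predT).
by apply: eq_seq_expect => s; rewrite all_predT.
Qed.

(* Chebyshev at 0: [1_{U = 0} <= (1 - U / mu)^2], where [U] counts the [k \in K]
   such that all steps satisfy [u k] and [mu] is the mean of [U]. *)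
Lemma seq_expect_none (I : finType) (K : {set I}) w t (u : I -> pred T) :
  (forall x, 0 <= w x) -> \sum_x w x = 1 ->
  {in K &, forall k l, k != l ->
    \sum_(x | u k x && u l x) w x <=
    (\sum_(x | u k x) w x) * \sum_(x | u l x) w x} ->
  0 < \sum_(k in K) (\sum_(x | u k x) w x) ^+ t ->
  seq_expect w t (fun s => [forall k in K, ~~ all (u k) s]%:R) <=
  (\sum_(k in K) (\sum_(x | u k x) w x) ^+ t)^-1.
Proof.
move=> w0 w1 neg; pose a k := \sum_(x | u k x) w x.
have a0 k : 0 <= a k by exact: sumr_ge0.
rewrite -/(\sum_(k in K) a k ^+ t); set mu := (X in 0 < X) => mu0.
pose U s : R := \sum_(k in K) (all (u k) s)%:R.
have EU : seq_expect w t U = mu.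
  by rewrite seq_expect_sum; apply: eq_bigr => k _; rewrite seq_expect_all.
have EU2 : seq_expect w t (fun s => U s ^+ 2) <= mu + mu ^+ 2.
  rewrite (eq_seq_expect w t (G := fun s =>
    \sum_(k in K) \sum_(l in K) (all (predI (u k) (u l)) s)%:R)); last first.
    move=> s; rewrite expr2 mulr_suml; apply: eq_bigr => k _.
    rewrite mulr_sumr; apply: eq_bigr => l _.
    by rewrite all_predI -natrM mulnb.
  rewrite seq_expect_sum [mu ^+ 2]expr2 {2}/mu mulr_suml -big_split /=.
  apply: ler_sum => k kK; rewrite seq_expect_sum (bigD1 k) //=.
  rewrite seq_expect_all lerD //.
    by rewrite (eq_bigl (u k)) // => x /=; rewrite andbb.
  rewrite mulr_sumr [leRHS](bigD1 k) //= -[leLHS]add0r lerD //.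
    by rewrite mulr_ge0 // exprn_ge0.
  apply: ler_sum => l /andP[lK lk]; rewrite seq_expect_all -exprMn.
  by rewrite lerXn2r ?nnegrE ?mulr_ge0 ?sumr_ge0 // neg // eq_sym.
apply: (@le_trans _ _
  (seq_expect w t (fun s => 1 + ((- 2 / mu) * U s + mu ^- 2 * U s ^+ 2)))).
  apply: le_seq_expect => // s.
  have -> : 1 + (- 2 / mu * U s + mu ^- 2 * U s ^+ 2) = (1 - U s / mu) ^+ 2.
    by field; rewrite gt_eqF.
  case: forallP => [H|_]; last by rewrite sqr_ge0.
  rewrite /U big1 ?mul0r ?subr0 ?expr1n // => k kK.
  by have := implyP (H k) kK; case: all.
rewrite !(seq_expectD, seq_expectZ) EU seq_expect1 //.
rewrite -/mu [leRHS](_ : _ = 1 + (- 2 / mu * mu + mu ^- 2 * (mu + mu ^+ 2))).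
  by rewrite !lerD2l ler_wpM2l // invr_ge0 exprn_ge0 // ltW.
by field; rewrite gt_eqF.
Qed.

End SequenceExpectation.

(** * Convolution powers of a mixture *)

Section Mixture.
Context {R : realType} {gT : finGroupType}.
Implicit Types (P Q F : gT -> R) (g : gT) (t : nat).

Local Notation delta1 := (fun g : gT => (g == 1%g)%:R : R).

(** Convolution is linear in its left factor, so the power expands into one choice of component per
    step. *)
Lemma conv_pow_mixture (T : finType) (w : T -> R) (Q : T -> gT -> R) P t g :
  (forall g, P g = \sum_x w x * Q x g) ->
  conv_pow P t g =
  seq_expect w t (fun s => foldr (fun x => conv (Q x)) delta1 s g).
Proof.
move=> PE; elim: t g => [|t IH] g //=.
rewrite /conv_pow /= -/(conv_pow _ _) {1}/conv.
transitivity (\sum_h \sum_x w x * (Q x h * conv_pow P t (h^-1 * g)%g)).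
  apply: eq_bigr => h _; rewrite PE mulr_suml.
  by apply: eq_bigr => x _; rewrite mulrA.
rewrite exchange_big; apply: eq_bigr => x _ /=.
rewrite -mulr_sumr seq_expect_sum; congr (_ * _).
by apply: eq_bigr => h _; rewrite seq_expectZ IH.
Qed.

(** Convolving on the left with a point mass is a translation, so the fold collapses to the
    indicator of a product. *)
Lemma conv_pow_dirac_mixture (T : finType) (w : T -> R) (f : T -> gT) P t g :
  (forall g, P g = \sum_x w x * (f x == g)%:R) ->
  conv_pow P t g = seq_expect w t (fun s => (\prod_(x <- s) f x == g)%g%:R).
Proof.
move=> PE; rewrite (conv_pow_mixture t g PE); apply: eq_seq_expect => s.
elim: s g => [|x s IH] g /=; first by rewrite big_nil eq_sym.
rewrite /conv (bigD1 (f x)) //= eqxx mul1r big1 => [|h hx]; last first.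
  by rewrite eq_sym (negPf hx) mul0r.
rewrite addr0 IH big_cons; congr (_%:R); congr nat_of_bool.
by rewrite -(inj_eq (mulgI (f x))) mulKVg.
Qed.

End Mixture.

(** * Separation distance from the uniform distribution *)

Section Separation.
Context {R : realType} {gT : finGroupType}.
Implicit Types (P Q : gT -> R) (t : nat).

Lemma conv_pow_ge0 P t g : (forall g, 0 <= P g) -> 0 <= conv_pow P t g.
Proof.
move=> P0; elim: t g => [|t IH] g; first exact: ler0n.
by apply: sumr_ge0 => h _; exact: mulr_ge0.
Qed.

Lemma sep_dist_ge P g : 1 - P g * #|gT|%:R <= sep_dist P (@uniform_dist R gT).
Proof. by rewrite -[X in P g * X]invrK; exact: le_bigmax. Qed.

Lemma sep_dist_le P (c : R) : (forall g, 1 - P g * #|gT|%:R <= c) ->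
  sep_dist P (@uniform_dist R gT) <= c.
Proof.
by move=> H; apply: bigmax_le => [|g _]; rewrite /uniform_dist invrK.
Qed.

Lemma sep_dist_le1 P :
  (forall g, 0 <= P g) -> sep_dist P (@uniform_dist R gT) <= 1.
Proof. by move=> P0; apply: sep_dist_le => g; rewrite lerBlDr lerDl mulr_ge0. Qed.

(** A negative value would put [P] strictly above the uniform distribution everywhere, forcing its
    mass above 1. *)
Lemma sep_dist_ge0 P : \sum_g P g = 1 -> 0 <= sep_dist P (@uniform_dist R gT).
Proof.
move=> P1; rewrite leNgt; apply/negP => sep0.
have G0 : 0 < #|gT|%:R :> R by rewrite ltr0n; apply/card_gt0P; exists 1%g.
suff : (1 : R) < 1 by rewrite ltxx.
rewrite -[X in _ < X]P1 -(mulVf (lt0r_neq0 G0)) mulr_natr -sumr_const.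
apply: ltr_sum => [|g _]; first by apply/hasP; exists 1%g; rewrite ?mem_index_enum.
rewrite -(ltr_pM2r G0) mulVf ?gt_eqF // -subr_lt0.
exact: le_lt_trans (sep_dist_ge P g) sep0.
Qed.

(** Pointwise, [P] is at least [1 - S] times the uniform distribution, where [S] is the distance.
    Summing over a set of density at least one half gives mass at least [(1 - S) / 2]. *)
Lemma sep_dist_ge_set P (B : {set gT}) :
  (forall g, 0 <= P g) -> (#|gT| <= 2 * #|B|)%N ->
  1 - 2 * \sum_(g in B) P g <= sep_dist P (@uniform_dist R gT).
Proof.
move=> P0 GB; set S := sep_dist _ _.
have G0 : 0 < #|gT|%:R :> R by rewrite ltr0n; apply/card_gt0P; exists 1%g.
have PS g : (1 - S) / #|gT|%:R <= P g.
  by rewrite ler_pdivrMr // lerBlDr -lerBlDl sep_dist_ge.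
have PB : #|B|%:R / #|gT|%:R * (1 - S) <= \sum_(g in B) P g.
  rewrite mulrAC -mulrA mulr_natl -sumr_const.
  exact: ler_sum.
have [S1|S1] := leP S 1; last first.
  have : 0 <= \sum_(g in B) P g by exact: sumr_ge0.
  lra.
have half : 1 / 2 <= #|B|%:R / #|gT|%:R :> R.
  by rewrite ler_pdivlMr // mulrAC ler_pdivrMr // mul1r -natrM ler_nat mulnC.
have := le_trans (ler_wpM2r _ half) PB; rewrite subr_ge0 => /(_ S1).
lra.
Qed.

End Separation.

(** Left-commutativity allows adjacent blocks to be exchanged, and such exchanges generate all
    rearrangements. *)
Lemma foldr_perm (T : eqType) (S : Type) (f : T -> S -> S) (z : S) :
  (forall x y u, f x (f y u) = f y (f x u)) ->
  forall s1 s2, perm_eq s1 s2 -> foldr f z s1 = foldr f z s2.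
Proof.
move=> fC; apply: catCA_perm_subst => s1 s2 s3; rewrite !foldr_cat.
move: (foldr f z s3) => u; elim: s1 => [//|x s1 IH] /=; rewrite IH {IH}.
by elim: s2 => [//|y s2 IH2] /=; rewrite fC IH2.
Qed.

(** * Averages of one-sided transpositions: commutation, product and the coupon collector bound *)

Section OneSidedTranspositions.
Context {R : realType} {n : nat}.
Implicit Types (F : 'S_n -> R) (i j k l : 'I_n) (g : 'S_n).

(** The group algebra element X_j, which is the law of one step given its upper position [j]. *)
Definition star j : 'S_n -> R :=
  fun g => j.+1%:R^-1 * \sum_(i < n | (i <= j)%N) (tperm i j == g)%:R.

Lemma conv_star j F g :
  conv (star j) F g =
  j.+1%:R^-1 * \sum_(i < n | (i <= j)%N) F (tperm i j * g)%g.
Proof.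
rewrite /conv /star.
under eq_bigr do rewrite -mulrA mulr_suml.
rewrite -mulr_sumr exchange_big /=; congr (_ * _); apply: eq_bigr => i _.
rewrite (bigD1 (tperm i j)) //= eqxx mul1r tpermV big1 ?addr0 // => h hij.
by rewrite eq_sym (negPf hij) mul0r.
Qed.

Lemma sum_le_const j (c : R) : \sum_(i < n | (i <= j)%N) c = j.+1%:R * c.
Proof.
rewrite -(big_ord_widen n (fun=> c) (ltn_ord j)).
by rewrite sumr_const card_ord mulr_natl.
Qed.

Lemma tperm_le_iff i j k l : (i <= j)%N -> (j <= k)%N ->
  (tperm i j l <= k)%N = (l <= k)%N.
Proof.
move=> ij jk; case: tpermP => [->|->|//]; last by rewrite jk (leq_trans ij).
by rewrite jk (leq_trans ij).
Qed.

(* For [j < k], conjugation by [tperm i j] with [i <= j] permutes the [tperm l k],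
   [l <= k]. *)
Lemma conv_starC j k F :
  conv (star j) (conv (star k) F) = conv (star k) (conv (star j) F).
Proof.
wlog jk : j k / (j < k)%N => [H|].
  by case: (ltngtP j k) => [/H //|/H //|/ord_inj -> //].
apply/funext => g; rewrite !conv_star.
under eq_bigr do rewrite conv_star.
under [in RHS]eq_bigr do rewrite conv_star.
rewrite -!mulr_sumr mulrCA; congr (_ * (_ * _)).
rewrite [RHS]exchange_big /=; apply: eq_bigr => i ij.
rewrite (reindex_inj (@perm_inj _ (tperm i j))) /=.
apply: eq_big => [l|l _]; first by rewrite tperm_le_iff // ltnW.
congr F; rewrite !mulgA; congr (_ * _)%g.
rewrite [RHS]conjgCV tpermV tpermJ (tpermD (z := k)) //.
- by rewrite neq_ltn (leq_ltn_trans ij).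
- by rewrite neq_ltn jk.
Qed.

(** Since [tperm i k * g] sends [k] to [g i], only [i = g^-1 k] can contribute; it satisfies
    [i <= k] as soon as [g] fixes every point above [k]. *)
Lemma sum_tperm_fix k g :
  \sum_(i < n | (i <= k)%N)
    [forall x : 'I_n, (k <= x)%N ==> ((tperm i k * g)%g x == x)]%:R =
  [forall x : 'I_n, (k.+1 <= x)%N ==> (g x == x)]%:R :> R.
Proof.
rewrite (eq_bigr (fun i => ((g i == k) &&
  [forall x : 'I_n, (k.+1 <= x)%N ==> (g x == x)])%:R)) => [|i ik]; last first.
  congr (nat_of_bool _)%:R; apply/forallP/andP => [H|[/eqP gi /forallP H] x].
    split; first by have := H k; rewrite leqnn permM tpermR.
    apply/forallP => x; apply/implyP => kx.
    have := H x; rewrite (ltnW kx) permM tpermD //=.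
      by rewrite neq_ltn (leq_ltn_trans ik).
    by rewrite neq_ltn kx.
  apply/implyP; rewrite leq_eqVlt permM => /orP[/eqP/ord_inj <-|kx].
    by rewrite tpermR gi.
  rewrite tpermD; first exact: implyP (H x) kx.
    by rewrite neq_ltn (leq_ltn_trans ik).
  by rewrite neq_ltn kx.
case: forallP => [H|_]; last by rewrite big1 // => i _; rewrite andbF.
have gk : g (g^-1%g k) = k by rewrite permKV.
rewrite (bigD1 (g^-1%g k)) /=.
  rewrite gk eqxx big1 ?addr0 // => i /andP[_ ik].
  by rewrite -{1}gk (inj_eq perm_inj) (negPf ik).
rewrite leqNgt; apply/negP => kg.
have /eqP := implyP (H (g^-1%g k)) kg.
by rewrite gk => kE; rewrite -kE ltnn in kg.
Qed.

(** The product of the first [m] stars is uniform on the permutations of the first [m] positions.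
    The reversal makes the newest star the leftmost factor, as [sum_tperm_fix] requires. *)
Lemma foldr_star_take m g : (m <= n)%N ->
  foldr (fun j => conv (star j)) (fun g => (g == 1%g)%:R)
    (rev (take m (enum 'I_n))) g =
  m`!%:R^-1 * [forall x : 'I_n, (m <= x)%N ==> (g x == x)]%:R.
Proof.
elim: m g => [|m IH] g mn.
  rewrite take0 /= fact0 invr1 mul1r; congr (_%:R); congr nat_of_bool.
  apply/eqP/forallP => [-> x|gx]; first by rewrite perm1.
  by apply/permP => x; rewrite perm1; exact/eqP/gx.
pose k := Ordinal mn.
rewrite (take_nth k) ?size_enum_ord // rev_rcons /=.
have -> : nth k (enum 'I_n) m = k by apply: ord_inj; rewrite nth_enum_ord.
rewrite conv_star; under eq_bigr do rewrite IH 1?ltnW //.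
by rewrite -mulr_sumr (sum_tperm_fix k) mulrA factS natrM invfM.
Qed.

(** By commutation one copy of each index moves to the inner end, where the product is uniform. The
    repeated draws, collected in [r], then average a constant function. *)
Lemma foldr_star_full (s : seq 'I_n) g : (forall j, j \in s) ->
  foldr (fun j => conv (star j)) (fun g => (g == 1%g)%:R) s g = n`!%:R^-1.
Proof.
move=> sT; set f := fun j => _; set z := fun g => _.
have fC j k F : f j (f k F) = f k (f j F) by exact: conv_starC.
have [r sr] := perm_to_subseq (undup_subseq s).
rewrite (foldr_perm z fC sr).
have su : perm_eq (undup s) (rev (take n (enum 'I_n))).
  rewrite take_oversize ?size_enum_ord // perm_sym perm_rev.
  apply: uniq_perm; rewrite ?enum_uniq ?undup_uniq // => j.
  by rewrite mem_enum mem_undup sT.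
have -> : foldr f z (undup s ++ r) = foldr f z (r ++ rev (take n (enum 'I_n))).
  apply: foldr_perm => //; rewrite perm_sym perm_catC.
  by rewrite perm_cat2r perm_sym.
rewrite foldr_cat.
have -> : foldr f z (rev (take n (enum 'I_n))) = fun=> n`!%:R^-1.
  apply/funext => h; rewrite foldr_star_take //.
  case: forallP => [_|[]]; first by rewrite mulr1.
  by move=> x; rewrite leqNgt ltn_ord.
elim: r {sr} g => [//|j r IH] g /=; rewrite {1}/f conv_star.
under eq_bigr do rewrite IH.
by rewrite sum_le_const mulKf ?pnatr_eq0.
Qed.

Lemma foldr_star_ge0 s g :
  0 <= foldr (fun j => conv (star j)) (fun g => (g == 1%g)%:R) s g.
Proof.
by elim: s g => [|j s IH] g //=; rewrite conv_star mulr_ge0 ?invr_ge0 ?sumr_ge0.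
Qed.

Lemma OST_star g : OST g = \sum_j n%:R^-1 * star j g :> R.
Proof.
apply: eq_bigr => j _; rewrite /star mulrA -invfM mulr_sumr big_mkcondr /=.
by apply: eq_bigr => i _; case: eqP => _; rewrite ?mulr1 ?mulr0.
Qed.

(** Condition on the sequence of upper positions. A sequence containing all of them contributes the
    exact uniform value, any other a nonnegative one. The subtracted term is the expected number of
    missed positions, a union bound. *)
Lemma OST_pow_ge t g : (0 < n)%N ->
  n`!%:R^-1 * (1 - n%:R * (1 - n%:R^-1) ^+ t) <= conv_pow (@OST R n) t g.
Proof.
move=> n0; rewrite (conv_pow_mixture t g OST_star).
have nR0 : n%:R != 0 :> R by rewrite pnatr_eq0 -lt0n.
pose missed (s : seq 'I_n) : R := \sum_k (all (predC1 k) s)%:R.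
have -> : n%:R * (1 - n%:R^-1) ^+ t = seq_expect (fun=> n%:R^-1) t missed :> R.
  rewrite seq_expect_sum (eq_bigr (fun=> (1 - n%:R^-1) ^+ t)) => [|k _].
    by rewrite sumr_const card_ord mulr_natl.
  rewrite seq_expect_all; congr (_ ^+ _).
  rewrite sumr_const; have := cardC1 k; rewrite card_ord => ->.
  by rewrite -[LHS]mulr_natl -subn1 natrB // mulrBl mulfV // mul1r.
have e1 : seq_expect (fun _ : 'I_n => n%:R^-1) t (fun=> 1) = 1 :> R.
  by apply: seq_expect1; rewrite sumr_const card_ord -[LHS]mulr_natl mulfV.
have -> : 1 - seq_expect (fun=> n%:R^-1) t missed =
    seq_expect (fun=> n%:R^-1) t (fun s => 1 + -1 * missed s).
  by rewrite seq_expectD e1 seq_expectZ mulN1r.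
rewrite -seq_expectZ; apply: le_seq_expect => s; rewrite ?invr_ge0 // mulN1r.
have [sT|/existsNP[k /negP ks]] := pselect (forall j, j \in s).
  rewrite foldr_star_full // ler_piMr ?invr_ge0 //.
  by rewrite lerBlDr lerDl sumr_ge0.
apply: le_trans (foldr_star_ge0 s g); rewrite mulr_ge0_le0 ?invr_ge0 //.
rewrite subr_le0 /missed (bigD1 k) //=.
have -> : all (predC1 k) s by apply/allP => x xs /=; apply: contraNneq ks => <-.
by rewrite lerDl sumr_ge0.
Qed.

(** * Probabilities that a step touches given positions, and their correlation *)

Definition ost_weight (x : 'I_n * 'I_n) : R :=
  if (x.1 <= x.2)%N then (n%:R * x.2.+1%:R)^-1 else 0.

Definition touches k (x : 'I_n * 'I_n) := (k == x.1) || (k == x.2).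

Lemma ost_weight_ge0 x : 0 <= ost_weight x.
Proof. by rewrite /ost_weight; case: ifP => // _; rewrite invr_ge0 mulr_ge0. Qed.

Lemma sum_ost_weight (c : 'I_n * 'I_n -> R) :
  \sum_x ost_weight x * c x =
  \sum_(j < n) n%:R^-1 * (j.+1%:R^-1 * \sum_(i < n | (i <= j)%N) c (i, j)).
Proof.
rewrite (eq_bigr (fun x => ost_weight (x.1, x.2) * c (x.1, x.2))); last by case.
rewrite -(pair_bigA _ (fun i j => ost_weight (i, j) * c (i, j))) exchange_big /=.
apply: eq_bigr => j _; rewrite mulrA -invfM mulr_sumr [RHS]big_mkcond /=.
by apply: eq_bigr => i _; rewrite /ost_weight /=; case: ifP; rewrite ?mul0r.
Qed.

Lemma sum_ost_weight1 : (0 < n)%N -> \sum_x ost_weight x = 1.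
Proof.
move=> n0; under eq_bigr do rewrite -[ost_weight _]mulr1.
rewrite sum_ost_weight (eq_bigr (fun=> n%:R^-1)) => [|j _].
  by rewrite sumr_const card_ord -[LHS]mulr_natl mulfV // pnatr_eq0 -lt0n.
by rewrite sum_le_const mulr1 mulVf ?mulr1 // pnatr_eq0.
Qed.

(** Unlike [OST_star], this mixture records both positions of a step, on which the touching events
    depend. *)
Lemma OST_tperm g :
  OST g = \sum_(x : 'I_n * 'I_n) ost_weight x * (tperm x.1 x.2 == g)%:R.
Proof. by rewrite OST_star sum_ost_weight. Qed.

Lemma OST_pow_seq t g :
  conv_pow (@OST R n) t g =
  seq_expect ost_weight t (fun s => (\prod_(x <- s) tperm x.1 x.2 == g)%g%:R).
Proof. exact: conv_pow_dirac_mixture OST_tperm. Qed.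

Lemma prod_tperm_untouched k (s : seq ('I_n * 'I_n)) :
  all (predC (touches k)) s -> (\prod_(x <- s) tperm x.1 x.2)%g k = k.
Proof.
elim: s => [|x s IH] /=; first by rewrite big_nil perm1.
rewrite negb_or => /andP[/andP[k1 k2] /IH ks].
by rewrite big_cons permM tpermD // eq_sym.
Qed.

Definition touch_prob k : R := \sum_(x | touches k x) ost_weight x.

Definition touch_prob2 k l : R :=
  \sum_(x | touches k x && touches l x) ost_weight x.

(** The 1 accounts for steps with upper position [k], the harmonic tail for steps in which [k] is
    the lower partner of some [j > k]. *)
Lemma touch_probE k :
  touch_prob k = n%:R^-1 * (1 + \sum_(j < n | (k < j)%N) j.+1%:R^-1).
Proof.
rewrite /touch_prob big_mkcond /=.
rewrite (eq_bigr (fun x => ost_weight x * (touches k x)%:R)) => [|x _]; last first.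
  by case: ifP; rewrite ?mulr1 ?mulr0.
rewrite sum_ost_weight -mulr_sumr; congr (_ * _).
rewrite (bigD1 k) //=; congr (_ + _).
  under eq_bigr do rewrite /touches /= eqxx orbT.
  by rewrite sum_le_const mulr1 mulVf // pnatr_eq0.
rewrite [RHS]big_mkcond [LHS]big_mkcond /=; apply: eq_bigr => j _.
case: eqP => [->|/eqP jk]; first by rewrite ltnn.
under eq_bigr do rewrite /touches /= [k == j]eq_sym (negPf jk) orbF.
case: (ltnP k j) => kj.
  rewrite (bigD1 k) 1?ltnW //= eqxx big1 ?addr0 ?mulr1 // => i /andP[_ ik].
  by rewrite eq_sym (negPf ik).
rewrite big1 ?mulr0 // => i ij; case: eqP => // ki.
have : j = k :> nat by apply/eqP; rewrite eqn_leq kj ki ij.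
by move/ord_inj => jkE; rewrite jkE eqxx in jk.
Qed.

(** The pair [(k, l)] is the only one of nonzero weight that touches both positions. *)
Lemma touch_prob2E k l : (k < l)%N ->
  touch_prob2 k l = (n%:R * l.+1%:R)^-1.
Proof.
move=> kl; rewrite /touch_prob2 (bigD1 (k, l)) /=; last by rewrite /touches !eqxx orbT.
rewrite big1 ?addr0 => [|[i j]]; first by rewrite /ost_weight /= ltnW.
rewrite /touches /ost_weight xpair_eqE /=.
case: (eqVneq k i) => [<-|ki] /=.
  case: (eqVneq l k) => [lk|_] /=; first by rewrite lk ltnn in kl.
  by move=> /andP[/eqP <-]; rewrite !eqxx.
move=> /andP[/andP[/eqP <-]].
case: (eqVneq l k) => [lk|_]; first by rewrite lk ltnn in kl.
by rewrite orbF => /eqP <- _; rewrite leqNgt kl.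
Qed.

Lemma sum_gt_const k (c : R) :
  \sum_(j < n | (k < j)%N) c = (n%:R - k.+1%:R) * c.
Proof.
have := sum_le_const k c.
have : \sum_(j < n) c = n%:R * c by rewrite sumr_const card_ord mulr_natl.
rewrite (bigID (fun j : 'I_n => (j <= k)%N)) /=.
rewrite [X in _ + X](eq_bigl (fun j : 'I_n => (k < j)%N)); last first.
  by move=> j; rewrite ltnNge.
by move=> nE kE; rewrite mulrBl -nE -kE addrAC subrr add0r.
Qed.

Lemma touch_prob_ge k :
  n%:R^-1 * (1 + (n%:R - k.+1%:R) / n%:R) <= touch_prob k.
Proof.
rewrite touch_probE ler_wpM2l ?invr_ge0 // lerD2l -sum_gt_const.
apply: ler_sum => j _.
by rewrite lef_pV2 ?posrE ?ltr0n // ?ler_nat // (leq_ltn_trans _ (ltn_ord k)).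
Qed.

Lemma touch_prob_le k :
  touch_prob k <= n%:R^-1 * (1 + (n%:R - k.+1%:R) / k.+1%:R).
Proof.
rewrite touch_probE ler_wpM2l ?invr_ge0 // lerD2l -sum_gt_const.
apply: ler_sum => j kj.
by rewrite lef_pV2 ?posrE ?ltr0n // ler_nat ltnW.
Qed.

Lemma untouched_prob k : (0 < n)%N ->
  \sum_(x | ~~ touches k x) ost_weight x = 1 - touch_prob k.
Proof.
move=> n0; rewrite -(sum_ost_weight1 n0) [in RHS](bigID (touches k)) /= /touch_prob.
by rewrite addrAC subrr add0r.
Qed.

Lemma untouched_prob2 k l : (0 < n)%N ->
  \sum_(x | ~~ touches k x && ~~ touches l x) ost_weight x =
  1 - touch_prob k - touch_prob l + touch_prob2 k l.
Proof.
move=> n0; have := untouched_prob k n0; rewrite (bigID (touches l)) /= => <-.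
have -> : \sum_(x | ~~ touches k x && touches l x) ost_weight x =
    touch_prob l - touch_prob2 k l.
  rewrite /touch_prob [in RHS](bigID (touches k)) /= addrC /touch_prob2.
  rewrite (eq_bigl _ _ (fun x => andbC (touches k x) (touches l x))).
  by rewrite addrK; apply: eq_bigl => x; rewrite andbC.
ring.
Qed.

(** By inclusion-exclusion this is also the negative correlation of the events that [k] and [l] stay
    untouched, as [seq_expect_none] requires. *)
Lemma touch_prob2_le k l : (k < l)%N -> (n <= 2 * l)%N ->
  touch_prob2 k l <= touch_prob k * touch_prob l.
Proof.
move=> kl nl; have n0 : (0 < n)%N := leq_ltn_trans (leq0n _) (ltn_ord l).
have nR0 : 0 < n%:R :> R by rewrite ltr0n.
have ln : l.+1%:R <= n%:R :> R by rewrite ler_nat.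
have nl' : n%:R <= 2 * l.+1%:R :> R by rewrite -natrM ler_nat; lia.
have kl' : k.+1%:R <= l.+1%:R :> R by rewrite ler_nat ltnW.
have lR : 0 < l.+1%:R :> R by rewrite ltr0n.
(* The bound of [touch_prob_ge] at the larger index [l]; it lies below both touch probabilities. *)
pose b : R := n%:R^-1 * (1 + (n%:R - l.+1%:R) / n%:R).
have b0 : 0 <= b.
  by rewrite mulr_ge0 ?invr_ge0 ?addr_ge0 ?divr_ge0 ?subr_ge0.
apply: (@le_trans _ _ (b * b)); last first.
  apply: ler_pM => //; last exact: touch_prob_ge.
  apply: le_trans (touch_prob_ge k).
  rewrite ler_wpM2l ?invr_ge0 // lerD2l ler_wpM2r ?invr_ge0 //.
  by rewrite lerB.
rewrite touch_prob2E // -subr_ge0 /b.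
move: (n%:R) (l.+1%:R) nR0 ln nl' lR => N L N0 LN NL L0.
have -> : N^-1 * (1 + (N - L) / N) * (N^-1 * (1 + (N - L) / N)) - (N * L)^-1 =
   (N - L) * (L * (3 * N - L) - N ^+ 2) / (N ^+ 4 * L).
  by field; rewrite !gt_eqF.
apply: divr_ge0; last by rewrite ltW // mulr_gt0 ?exprn_gt0.
apply: mulr_ge0; first by rewrite subr_ge0.
(* The remaining factor equals [(N - L) * (2 * L - N) + L ^+ 2]. *)
have : 0 <= (N - L) * (2 * L - N) by rewrite mulr_ge0 ?subr_ge0.
have : 0 <= L ^+ 2 by exact: sqr_ge0.
lra.
Qed.

Lemma OST_ge0 g : 0 <= OST g :> R.
Proof. by rewrite OST_tperm sumr_ge0 // => x _; rewrite mulr_ge0 ?ost_weight_ge0. Qed.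

Lemma sum_OST_pow t : (0 < n)%N -> \sum_g conv_pow (@OST R n) t g = 1.
Proof.
move=> n0; under eq_bigr do rewrite OST_pow_seq.
rewrite -seq_expect_sum -[RHS](seq_expect1 t (sum_ost_weight1 n0)).
apply: eq_seq_expect => s.
rewrite (bigD1 (\prod_(x <- s) tperm x.1 x.2)%g) //= eqxx big1 ?addr0 // => g gs.
by rewrite eq_sym (negPf gs).
Qed.

(** * The last positions and the lower bound for the separation distance *)

Definition late (m : nat) : {set 'I_n} := [set k : 'I_n | (n - m <= k)%N].

Lemma card_late m : (m <= n)%N -> #|late m| = m.
Proof.
move=> mn; apply/eqP; rewrite -(eqn_add2r #|~: late m|) cardsC card_ord.
suff -> : #|~: late m| = (n - m)%N by rewrite subnKC.
rewrite -[RHS]card_ord -sum1_card -[RHS]sum1_card.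
rewrite (big_ord_widen n (fun=> 1%N) (leq_subr m n)).
by apply: eq_bigl => k; rewrite !inE ltnNge.
Qed.

Definition late_deranged (m : nat) : {set 'S_n} :=
  [set g : 'S_n | [forall k in late m, g k != k]].

Lemma card_perm_fix k : #|[pred g : 'S_n | g k == k]| = n.-1`!.
Proof.
rewrite -[in RHS](card_ord n) -(cardsC1 k) -card_perm; apply: eq_card => g.
rewrite !inE; apply/eqP/idP => [gk|/out_perm]; last first.
  by apply; rewrite !inE eqxx.
by apply/fintype.subsetP => x; rewrite !inE; apply: contraNneq => ->; rewrite gk.
Qed.

(** Union bound: at most [m * (n - 1)!] permutations fix some late position, which is at most half
    of [n!]. *)
Lemma card_late_deranged m : (2 * m <= n)%N ->
  (#|{: 'S_n}| <= 2 * #|late_deranged m|)%N.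
Proof.
(* The case [m = 0] allows [n = 0], where the factorisation of [n!] used below fails. *)
case: (posnP m) => [-> _|m0 mn].
  rewrite -finset.cardsT (_ : late_deranged 0 = finset.setT) ?leq_pmull //.
  apply/setP => g; rewrite !inE; apply/forall_inP => k.
  by rewrite inE subn0 leqNgt ltn_ord.
have n0 : (0 < n)%N by lia.
have : (#|~: late_deranged m| <= m * n.-1`!)%N.
  rewrite -[X in (_ <= X * _)%N](@card_late m); last by lia.
  rewrite -sum_nat_const -sum1_card.
  apply: (@leq_trans (\sum_(g : 'S_n) \sum_(k in late m) (g k == k))%N).
    rewrite [leqLHS]big_mkcond /=; apply: leq_sum => g _; case: ifP => //.
    rewrite !inE negb_forall => /existsP[k].
    rewrite negb_imply negbK => /andP[kl gk].
    by rewrite (bigD1 k) //= gk.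
  rewrite exchange_big; apply: leq_sum => k _ /=.
  rewrite -(card_perm_fix k) -sum1_card [leqRHS]big_mkcond /=.
  by apply: leq_sum => g _; rewrite inE; case: (g k == k).
have := cardsC (late_deranged m); rewrite cardT -cardE card_Sn.
have -> : n`! = (n * n.-1`!)%N by rewrite -[in LHS](prednK n0) factS prednK.
have : (2 * m * n.-1`! <= n * n.-1`!)%N by rewrite leq_mul2r mn orbT.
lia.
Qed.

(** The walk can lie in [late_deranged m] only once every late position has been touched. The second
    moment method bounds that probability by the inverse of the mean number of untouched late
    positions, and the set has density at least one half. *)
Lemma OST_sep_ge m t : (2 < n)%N -> (0 < m)%N -> (2 * m <= n)%N ->
  1 - 2 / (m%:R * (1 - n%:R^-1 * (1 + 2 * m%:R / n%:R)) ^+ t) <=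
  sep_dist (conv_pow (@OST R n) t) (@uniform_dist R 'S_n).
Proof.
move=> n2 m0 mn; have n0 : (0 < n)%N by lia.
have nR0 : 0 < n%:R :> R by rewrite ltr0n.
have mnR : 2 * m%:R / n%:R <= 1 :> R.
  by rewrite ler_pdivrMr // mul1r -natrM ler_nat.
set q := n%:R^-1 * _.
(* Here [q] is at most [2 / n], hence the condition [2 < n]. *)
have q1 : q < 1.
  rewrite /q mulrC ltr_pdivrMr // mul1r.
  have : 3 <= n%:R :> R by rewrite ler_nat.
  by move: mnR; lra.
apply: le_trans (sep_dist_ge_set _ (card_late_deranged mn)); last first.
  by move=> g; apply: conv_pow_ge0; exact: OST_ge0.
have lateP k : k \in late m -> (n <= 2 * k)%N by rewrite inE; lia.
(* For late [k], [n - k.+1] is at most [m] and [k.+1] at least [n / 2], so the quotient in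
   [touch_prob_le] is at most [2 * m / n]. *)
have a_ge k : k \in late m -> 1 - q <= 1 - touch_prob k.
  move=> kl; rewrite lerD2l lerN2; apply: le_trans (touch_prob_le k) _.
  rewrite /q ler_wpM2l ?invr_ge0 // lerD2l ler_pdivrMr ?ltr0n //.
  rewrite mulrAC ler_pdivlMr // mulrC mulrAC.
  apply: ler_pM; rewrite ?ler0n ?subr_ge0 ?ler_nat //; last first.
    by rewrite lerBlDr -natrD ler_nat; move: kl; rewrite inE; lia.
  by rewrite -natrM ler_nat; have := lateP k kl; lia.
pose mu := \sum_(k in late m)
  (\sum_(x | predC (touches k) x) ost_weight x) ^+ t.
have mu_ge : m%:R * (1 - q) ^+ t <= mu.
  rewrite -[in leLHS](@card_late m); last by lia.
  rewrite mulr_natl -sumr_const; apply: ler_sum => k kl.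
  have q0 : 0 <= 1 - q by rewrite subr_ge0 ltW.
  by rewrite untouched_prob // lerXn2r ?nnegrE ?(le_trans q0) ?a_ge.
have mq0 : 0 < m%:R * (1 - q) ^+ t.
  by rewrite mulr_gt0 ?ltr0n // exprn_gt0 // subr_gt0.
rewrite lerD2l lerN2 ler_wpM2l //.
apply: (@le_trans _ _ mu^-1); last first.
  by rewrite lef_pV2 ?posrE // (lt_le_trans mq0).
apply: le_trans (seq_expect_none _ (sum_ost_weight1 n0) _ _).
- under eq_bigr do rewrite OST_pow_seq.
  rewrite -seq_expect_sum; apply: le_seq_expect => [|s].
    exact: ost_weight_ge0.
  set p := (\prod_(x <- s) _)%g.
  have [pl|pl] := boolP (p \in late_deranged m); last first.
    rewrite big1 // => g gl; case: eqP => // pg.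
    by rewrite pg gl in pl.
  rewrite (bigD1 p) //= eqxx big1 ?addr0 => [|g /andP[_ gp]]; last first.
    by rewrite eq_sym (negPf gp).
  case: forall_inP => // H; exfalso; apply: H => k kl; apply/negP => ks.
  move: pl; rewrite inE => /forall_inP /(_ k kl).
  by rewrite prod_tperm_untouched ?eqxx.
- exact: ost_weight_ge0.
- move=> k l kl ll kl_neq /=; rewrite untouched_prob2 // !untouched_prob //.
  suff : touch_prob2 k l <= touch_prob k * touch_prob l by nra.
  wlog lt_kl : k l kl ll kl_neq / (k < l)%N => [H|].
    case: (ltngtP k l) => [/H ->//|lk|/ord_inj klE]; last by rewrite klE eqxx in kl_neq.
    rewrite mulrC /touch_prob2 (eq_bigl (fun x => touches l x && touches k x)).
      by rewrite H // eq_sym.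
    by move=> x; rewrite andbC.
  by rewrite touch_prob2_le // lateP.
- exact: lt_le_trans mq0 mu_ge.
Qed.

End OneSidedTranspositions.

(** * Asymptotics on both sides of [n * ln n] *)

Section Cutoff.
Local Open Scope classical_set_scope.
Local Open Scope ring_scope.
Context {R : realType}.
Implicit Types (n t : nat) (c : R).

(** The factor [sqrt (ln n)] makes the inner limits exactly 0 and 1 for each fixed large [c]. The
    value 1 for small [n] keeps the window positive. *)
Definition window (n : nat) : R :=
  if (1 < n)%N then n%:R * Num.sqrt (ln n%:R) else 1.

Lemma OST_sep_le n t : (0 < n)%N ->
  sep_dist (conv_pow (@OST R n) t) (@uniform_dist R 'S_n) <=
  expR (ln n%:R - t%:R / n%:R).
Proof.
move=> n0; have nR0 : 0 < n%:R :> R by rewrite ltr0n.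
apply: (@le_trans _ _ (n%:R * (1 - n%:R^-1) ^+ t)).
  apply: sep_dist_le => g.
  rewrite cardT -cardE card_Sn lerBlDr -lerBlDl.
  rewrite -ler_pdivrMr ?ltr0n ?fact_gt0 // mulrC.
  exact: OST_pow_ge.
rewrite expRD lnK ?posrE // ler_wpM2l ?ler0n //.
rewrite -mulrN expRM_natl lerXn2r ?nnegrE ?expR_ge0 ?expR_ge1Dx //.
by rewrite subr_ge0 invf_le1 // ler1n.
Qed.

(** With [s = sqrt (ln n)] the exponent in [OST_sep_le] is at most [1 - c * s], the 1 paying for the
    truncated time. The quadratic term of [expR (c * s)] then gives the rate [1 / ln n]. *)
Lemma OST_sep_upper n c : (1 < n)%N -> 0 < c ->
  sep_dist (walk_at (@OST R n) (n%:R * ln n%:R + c * window n))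
    (@uniform_dist R 'S_n) <= 2 * expR 1 / c ^+ 2 / ln n%:R.
Proof.
move=> n1 c0; have n0 : (0 < n)%N by lia.
have n1R : 1 < n%:R :> R by rewrite ltr1n.
have nR0 : 0 < n%:R :> R by rewrite ltr0n.
have L0 : 0 < ln n%:R :> R by rewrite ln_gt0.
apply: le_trans (OST_sep_le _ n0) _; rewrite /window n1.
set s := Num.sqrt _; have s0 : 0 < s by rewrite sqrtr_gt0.
have sE : ln n%:R = s ^+ 2 by rewrite sqr_sqrtr // ltW.
rewrite sE; set x := n%:R * s ^+ 2 + _; have x0 : 0 <= x.
  by rewrite addr_ge0 ?mulr_ge0 ?exprn_ge0 ?(ltW c0) ?(ltW s0).
have /andP[_ xt] := truncn_itv x0.
apply: (@le_trans _ _ (expR (1 - c * s))).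
  rewrite ler_expR lerBlDr -lerBlDl ler_pdivlMr //.
  have -> : (s ^+ 2 - (1 - c * s)) * n%:R = x - n%:R by rewrite /x; ring.
  move: xt; rewrite -natr1; lra.
have -> : 2 * expR 1 / c ^+ 2 / s ^+ 2 = expR 1 * ((c * s) ^+ 2 / 2)^-1.
  by field; rewrite !gt_eqF.
rewrite expRD expRN ler_wpM2l ?expR_ge0 //.
rewrite lef_pV2 ?posrE ?expR_gt0 ?divr_gt0 ?exprn_gt0 ?mulr_gt0 //.
by apply: le_trans (expR_ge1Dxn 1 _); rewrite ?lerDr // ltW // mulr_gt0.
Qed.

(** From [1 / (1 - q) = 1 + q / (1 - q)], which is at most [expR (q / (1 - q))]. *)
Lemma onem_exp_ge (q : R) t : 0 <= q -> q < 1 ->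
  expR (- (t%:R * (q / (1 - q)))) <= (1 - q) ^+ t.
Proof.
move=> q0 q1; have q1' : 0 < 1 - q by rewrite subr_gt0.
rewrite -mulrN expRM_natl lerXn2r ?nnegrE ?expR_ge0 ?(ltW q1') //.
rewrite expRN invf_ple ?posrE ?expR_gt0 //.
apply: le_trans (expR_ge1Dx _).
by rewrite le_eqVlt; apply/orP; left; apply/eqP; field; rewrite gt_eqF.
Qed.

(** Take [m] close to [n / L] in [OST_sep_ge], with [L = ln n]: the mean number of untouched late
    positions is then at least [L / (3 * expR 6)]. *)
Lemma OST_sep_lower n c : 2 <= c -> 4 <= ln n%:R :> R ->
  1 - 6 * expR 6 / ln n%:R <=
  sep_dist (walk_at (@OST R n) (n%:R * ln n%:R - c * window n))
    (@uniform_dist R 'S_n).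
Proof.
move=> c2 L4.
have n1 : (1 < n)%N.
  rewrite ltnNge; apply/negP => n1.
  suff : ln n%:R <= 0 :> R by lra.
  by rewrite ln_le0 // lern1.
have n0 : (0 < n)%N by lia.
have nR0 : 0 < n%:R :> R by rewrite ltr0n.
rewrite /walk_at /window n1.
set L := ln n%:R; set s := Num.sqrt _.
have s0 : 0 <= s by exact: sqrtr_ge0.
have sE : s ^+ 2 = L by rewrite sqr_sqrtr //; move: L4; rewrite -/L; lra.
have s2 : 2 <= s.
  by rewrite -(@ler_pXn2r _ 2) ?nnegrE // sE -natrX.
have nL : n%:R = expR L by rewrite lnK.
have n2L : 2 * L <= n%:R.
  rewrite nL; apply: le_trans (expR_ge1Dxn 1 _); last by move: L4; rewrite -/L; lra.
  move: L4; rewrite -/L (_ : 2`! = 2%N) // => L4.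
  have : 0 <= L * (L - 4) by rewrite mulr_ge0 ?subr_ge0 //; lra.
  lra.
have n8 : 8 <= n%:R :> R by move: n2L L4; rewrite -/L; lra.
set t := Num.truncn _.
have tX : t%:R <= n%:R * (L - 2 * s).
  have Xy : n%:R * L - c * (n%:R * s) <= n%:R * (L - 2 * s).
    have : 0 <= n%:R * s * (c - 2) by rewrite mulr_ge0 ?subr_ge0 ?mulr_ge0.
    lra.
  have [y0|y0] := leP 0 (n%:R * L - c * (n%:R * s)).
    by apply: le_trans Xy; have /andP[] := truncn_itv y0.
  (* A negative time truncates to 0, while [L - 2 * s = s * (s - 2)] is nonnegative. *)
  rewrite /t truncn_floor (lt_geF y0) mulr_ge0 // -sE.
  have : 0 <= s * (s - 2) by rewrite mulr_ge0 ?subr_ge0.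
  lra.
have L0 : 0 < L by move: L4; rewrite -/L; lra.
(* [n / L] late positions are few enough that their touch rate exceeds [1 / n]
   only by a factor [1 + O(1 / L)], which costs [exp (O(1))] over [n * L] steps. *)
set m := Num.truncn (n%:R / L).
have nL0 : 0 <= n%:R / L by rewrite divr_ge0 // ltW.
have /andP[m_le m_gt] := truncn_itv nL0.
(* Rounding down loses at most a factor 2, because [n / L] is at least 2. *)
have m_ge : n%:R / (2 * L) <= m%:R.
  have : 1 <= n%:R / (2 * L) by rewrite ler_pdivlMr ?mul1r // mulr_gt0.
  have : n%:R / L = 2 * (n%:R / (2 * L)) by field; rewrite gt_eqF.
  by move: m_gt; rewrite -/m -natr1; lra.
have m0 : (0 < m)%N.
  by rewrite -(ltr0n R) (lt_le_trans _ m_ge) // divr_gt0 // mulr_gt0.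
have mn : (2 * m <= n)%N.
  rewrite -(ler_nat R) natrM; move: m_le; rewrite -/m ler_pdivlMr //.
  move: L4; rewrite -/L; have : 0 <= m%:R :> R by [].
  nra.
have n2 : (2 < n)%N by rewrite -(ltr_nat R); lra.
apply: le_trans (OST_sep_ge t n2 m0 mn).
set q := n%:R^-1 * _.
rewrite lerD2l lerN2.
pose d : R := 2 * m%:R / n%:R.
have dL : d * L <= 2.
  have : m%:R * L <= n%:R by rewrite -ler_pdivlMr.
  by rewrite /d mulrAC ler_pdivrMr //; lra.
have d1 : d <= 1 by rewrite ler_pdivrMr // mul1r -natrM ler_nat.
have d0 : 0 <= d by rewrite divr_ge0.
have qn : q * n%:R = 1 + d by rewrite /q mulrAC mulVf ?mul1r ?gt_eqF.
have q0 : 0 <= q by rewrite mulr_ge0 // ?invr_ge0 // addr_ge0.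
have q14 : q <= 1 / 4.
  rewrite -(ler_pM2r nR0) qn; lra.
have q1 : q < 1 by lra.
(* With [r = 1 + d + r * q], the excess of [(L - 2 * s) * r] over [L - 2 * s] is at most
   [d * L + r * q * L], hence at most [2 + 3]; 6 is a round bound. *)
have tq : t%:R * (q / (1 - q)) <= L - 2 * s + 6.
  pose r := n%:R * (q / (1 - q)).
  have rE : r = 1 + d + r * q.
    by rewrite -qn /r; field; lra.
  have r0 : 0 <= r by rewrite mulr_ge0 ?divr_ge0 // subr_ge0 ltW.
  have r3 : r <= 3.
    have : 0 <= r * (1 / 4 - q) by rewrite mulr_ge0 // subr_ge0.
    lra.
  have qL : q * L <= 1.
    have : 0 <= q * (n%:R - 2 * L) by rewrite mulr_ge0 // subr_ge0.
    lra.
  have A0 : 0 <= L - 2 * s.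
    have : 0 <= s * (s - 2) by rewrite mulr_ge0 ?subr_ge0.
    by rewrite -sE; lra.
  apply: (@le_trans _ _ ((L - 2 * s) * r)).
    rewrite /r [leRHS]mulrCA [leRHS]mulrA ler_wpM2r // divr_ge0 // subr_ge0; lra.
  have h1 : 0 <= s * d by rewrite mulr_ge0.
  have h2 : 0 <= s * (r * q) by rewrite mulr_ge0 // mulr_ge0.
  have h3 : r * (q * L) <= 3 * 1 by apply: ler_pM => //; rewrite mulr_ge0 // ltW.
  rewrite rE; lra.
have pow_ge : expR (- (L - 2 * s + 6)) <= (1 - q) ^+ t.
  apply: le_trans (onem_exp_ge t q0 q1).
  by rewrite ler_expR lerN2.
(* The fourth-order term of the exponential is used so that a factor [L] survives division by the
   [2 * L] coming from [m_ge]. *)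
have exp2s : 2 / 3 * L ^+ 2 <= expR (2 * s).
  apply: le_trans (expR_ge1Dxn 3 _); last by rewrite mulr_ge0.
  rewrite -sE; set f := _`!; have {f}-> : f = 24%N by [].
  have -> : (2 * s) ^+ 4 / 24 = 2 / 3 * (s ^+ 2) ^+ 2 by field.
  by rewrite lerDr.
have mu_ge : L / (3 * expR 6) <= m%:R * (1 - q) ^+ t.
  apply: le_trans (ler_pM _ _ m_ge pow_ge); rewrite ?expR_ge0 //; last first.
    by rewrite divr_ge0 // mulr_ge0 // ltW.
  have -> : - (L - 2 * s + 6) = - L + (2 * s) + - 6 by ring.
  rewrite (expRD _ (- 6)) (expRD _ (2 * s)) !expRN -nL.
  have -> : n%:R / (2 * L) * (n%:R^-1 * expR (2 * s) / expR 6) =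
    expR (2 * s) / (2 * L * expR 6).
    by field; rewrite !gt_eqF ?expR_gt0.
  rewrite ler_pdivlMr ?mulr_gt0 ?expR_gt0 //.
  have -> : L / (3 * expR 6) * (2 * L * expR 6) = 2 / 3 * L ^+ 2.
    by field; rewrite !gt_eqF ?expR_gt0.
  exact: exp2s.
have -> : 6 * expR 6 / L = 2 / (L / (3 * expR 6)).
  by field; rewrite !gt_eqF ?expR_gt0.
rewrite ler_wpM2l // lef_pV2 ?posrE //.
  by rewrite mulr_gt0 ?ltr0n // exprn_gt0 // subr_gt0.
by rewrite divr_gt0 // mulr_gt0 // expR_gt0.
Qed.

Lemma ln_nat_cvgy : (ln n%:R : R) @[n --> \oo] --> +oo.
Proof.
apply/cvgryPge => A; near=> n.
have An : expR A <= n%:R by near: n; exact: nbhs_infty_ger.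
by rewrite -ler_expR lnK // posrE (lt_le_trans _ An) ?expR_gt0.
Unshelve. all: by end_near. Qed.

(** The error bound tends to 0, so [f] converges and both extended limits equal its limit. In the
    application [C] may depend on [c] but not on [n]. *)
Lemma limn_einf_sup_ln (f : nat -> R) (l C : R) :
  (\forall n \near \oo, `|f n - l| <= C / ln n%:R) ->
  limn_einf (EFin \o f) = l%:E /\ limn_esup (EFin \o f) = l%:E.
Proof.
move=> fl; suff fc : (f n)%:E @[n --> \oo] --> l%:E.
  by have [-> ->] := cvg_limn_einf_sup fc.
apply: cvg_EFin; first exact: nearW.
have Cln : C / ln n%:R @[n --> \oo] --> (0 : R).
  rewrite -(mulr0 C); apply: cvgMl_tmp; apply/gtr0_cvgV0; last exact: ln_nat_cvgy.
  near=> n; rewrite (@lt_le_trans _ _ 1) //.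
  by near: n; apply: cvgry_ge; exact: ln_nat_cvgy.
apply: (@squeeze_cvgr _ _ _ _ (fun n => l - C / ln n%:R) (fun n => l + C / ln n%:R)).
- by apply: filterS fl => n; rewrite ler_distl.
- by rewrite -[X in _ --> X]subr0; apply: cvgB => //; exact: cvg_cst.
- by rewrite -[X in _ --> X]addr0; apply: cvgD => //; exact: cvg_cst.
Unshelve. all: by end_near. Qed.

(** The ratio is [1 / sqrt (ln n)], at most [e] once [ln n] reaches [e^-1 ^+ 2]. *)
Lemma window_littleo :
  window =o_\oo (fun n => n%:R * ln n%:R : R).
Proof.
apply/eqoP => e e0; near=> n.
have n1 : (1 < n)%N by near: n; exact: nbhs_infty_gt.
have Le : e^-1 ^+ 2 <= ln n%:R.
  by near: n; apply: cvgry_ge; exact: ln_nat_cvgy.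
have L0 : 0 <= ln n%:R :> R by rewrite (le_trans _ Le) // sqr_ge0.
have s0 : 0 <= Num.sqrt (ln n%:R) :> R by exact: sqrtr_ge0.
rewrite /window n1 !ger0_norm ?mulr_ge0 // mulrCA ler_wpM2l //.
rewrite -[in leRHS](sqr_sqrtr L0) expr2 mulrA ler_peMl //.
rewrite mulrC -ler_pdivrMr // mul1r.
by rewrite -(@ler_pXn2r _ 2) ?nnegrE // ?sqr_sqrtr // invr_ge0 ltW.
Unshelve. all: by end_near. Qed.

End Cutoff.

Theorem theorem3p7p2 (R : realType) :
  @sep_cutoff R (fun n : nat => 'S_n)
    (fun n : nat => @OST R n)
    (fun n : nat => @uniform_dist R 'S_n)
    (fun n : nat => n%:R * ln n%:R).
Proof.
exists window; split.
- move=> n; rewrite /window; case: ifP => // n1.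
  by rewrite mulr_gt0 ?ltr0n ?sqrtr_gt0 ?ln_gt0 ?ltr1n // ltnW.
- exact: window_littleo.
(* For every fixed [c > 0] the upper limit in [n] is already 0, so the outer limit is that of an
   eventually constant function; the lower limit is treated likewise with [c >= 2]. *)
- apply: cvg_near_cst; near=> c.
  have c0 : 0 < c by near: c; exact: nbhs_pinfty_gt.
  apply: (limn_einf_sup_ln (C := 2 * expR 1 / c ^+ 2) _).2; near=> n.
  have n1 : (1 < n)%N by near: n; exact: nbhs_infty_gt.
  rewrite subr0 ger0_norm; first exact: OST_sep_upper.
  by rewrite sep_dist_ge0 // sum_OST_pow // ltnW.
- apply: cvg_near_cst; near=> c.
  have c2 : 2 <= c by near: c; exact: nbhs_pinfty_ge.
  apply: (limn_einf_sup_ln (C := 6 * expR 6) _).1; near=> n.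
  have L4 : 4 <= ln n%:R :> R by near: n; apply: cvgry_ge; exact: ln_nat_cvgy.
  rewrite distrC ger0_norm; first by rewrite lerBlDr -lerBlDl OST_sep_lower.
  rewrite subr_ge0 sep_dist_le1 // => g.
  by apply: conv_pow_ge0 => h; exact: OST_ge0.
Unshelve. all: by end_near. Qed.
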